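(* Let $G$ be a non-discrete countable metrizable abelian topological group, and let $\mathcal{C}$ be the group ideal of all precompact subsets of $G$. Then $\operatorname{asdim}(G,\mathcal{C})=\infty$.
   Context: A coarse structure on a set $X$ is a family $\mathcal{E}$ of subsets of $X\times X$ such that: the diagonal $\triangle_X=\{(x,x):x\in X\}$ belongs to $\mathcal{E}$; if $E,E'\in\mathcal{E}$ then $E\circ E'\in\mathcal{E}$ and $E^{-1}\in\mathcal{E}$, where $E\circ E'=\{(x,y):\exists z\,((x,z)\in E,\ (z,y)\in E')\}$ and $E^{-1}=\{(y,x):(x,y)\in E\}$; if $E,E'\in\mathcal{E}$ and $H\subseteq E$ then $E\cup E'\in\mathcal{E}$ and $H\in\mathcal{E}$. The pair $(X,\mathcal{E})$ is called a coarse space. A subfamily $\mathcal{E}'\subseteq\mathcal{E}$ is a base of $\mathcal{E}$ if every $E\in\mathcal{E}$ is contained in some $E'\in\mathcal{E}'$. For $x\in X$, $A\subseteq X$, $E\in\mathcal{E}$, put $E[x]=\{y\in X:(x,y)\in E\}$ and $E[A]=\bigcup_{a\in A}E[a]$. For $E\in\mathcal{E}$, a family $\mathcal{M}$ of subsets of $X$ is $E$-bounded if for each $A\in\mathcal{M}$ there is $x\in X$ with $A\subseteq E[x]$; it is $E$-disjoint if $E[A]\cap B=\emptyset$ for all distinct $A,B\in\mathcal{M}$. For an integer $n\ge 0$, $\operatorname{asdim}(X,\mathcal{E})\le n$ means: for each $E\in\mathcal{E}$ there exist $F\in\mathcal{E}$ and an $F$-bounded covering $\mathcal{M}$ of $X$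 which can be partitioned as $\mathcal{M}=\mathcal{M}_0\cup\dots\cup\mathcal{M}_n$ so that each family $\mathcal{M}_i$ is $E$-disjoint. If there is a minimal $n$ with this property then $\operatorname{asdim}(X,\mathcal{E})=n$; otherwise $\operatorname{asdim}(X,\mathcal{E})=\infty$. A group ideal on a group $G$ is a family $\mathcal{I}$ of subsets of $G$ that contains all finite subsets of $G$ and such that $A,B\in\mathcal{I}$, $C\subseteq A$ imply $AB^{-1}\in\mathcal{I}$ and $C\in\mathcal{I}$. The coarse space $(G,\mathcal{I})$ is $G$ with the coarse structure having base $\{\{(x,y)\in G\times G: x\in Ay\}\cup\triangle_G: A\in\mathcal{I}\}$ (group operation written multiplicatively). For a topological group $G$, a subset $A\subseteq G$ is precompact if its closure in $G$ is compact, and $\mathcal{C}$ denotes the group ideal of all precompact subsets of $G$. *)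

(* Defs.v *)
From mathcomp Require Import all_boot all_order all_algebra.
From mathcomp Require Import all_classical all_reals all_analysis.

Set Implicit Arguments.
Unset Strict Implicit.
Unset Printing Implicit Defensive.

Import Order.TTheory GRing.Theory Num.Theory.

Local Open Scope classical_set_scope.
Local Open Scope ring_scope.

Record coarse_structure (X : Type) := CoarseStructure {
  controlled :> set (X * X) -> Prop ;
  controlled_diagonal : controlled diagonal ;
  controlled_comp : forall E E', controlled E -> controlled E' ->
    controlled (E' \; E)%relation ;
  controlled_inv : forall E, controlled E ->
    controlled (E^-1)%relation ;
  controlledU : forall E E', controlled E -> controlled E' ->
    controlled (E `|` E') ;
  controlled_sub : forall E H, controlled E -> H `<=` E -> controlled H }.

Section asymptotic_dimension.
Context {X : Type}.
Implicit Types (E F : set (X * X)) (M : set (set X)) (C : coarse_structure X).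

(* [xsection E x] is E[x] *)
Definition bounded_family E M :=
  forall A, M A -> exists x, A `<=` xsection E x.

Definition disjoint_family E M :=
  forall A B, M A -> M B -> A <> B ->
    (\bigcup_(a in A) xsection E a) `&` B = set0.

(* The pieces [N i] of the partition are pairwise disjoint as families (no set
   is listed twice) and may be empty. *)
Definition asdim_le C (n : nat) :=
  forall E, C E -> exists2 F, C F & exists M : set (set X),
    [/\ \bigcup_(A in M) A = setT, bounded_family F M
      & exists N : 'I_n.+1 -> set (set X),
          [/\ M = \bigcup_i N i, trivIset setT N
            & forall i, disjoint_family E (N i)]].

(* The least [n] with [asdim_le C n], or [+oo] if there is none. *)
Definition asdim C : extended nat :=
  if pselect (exists n, `[< asdim_le C n >]) is left h
  then (ex_minn h)%:E else +oo%E.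

Lemma asdim_pinftyP C : asdim C = +oo%E <-> forall n, ~ asdim_le C n.
Proof.
rewrite /asdim; case: pselect => [h|h]; split=> //.
- by move=> hN; exfalso; case: h => n /asboolP; exact: hN.
- by move=> _ n hn; apply: h; exists n; apply/asboolP.
Qed.

Lemma asdim_finP C n : asdim C = n%:E <->
  asdim_le C n /\ forall m, asdim_le C m -> (n <= m)%N.
Proof.
rewrite /asdim; case: pselect => [h|h]; split=> //.
- case: ex_minnP => k /asboolP hk kmin [<-]; split=> // m hm.
  by apply: kmin; apply/asboolP.
- case: ex_minnP => k /asboolP hk kmin [hn nmin]; congr (_%:E).
  by apply/eqP; rewrite eqn_leq nmin// andbT; apply: kmin; apply/asboolP.
- by move=> [hn _]; exfalso; apply: h; exists n; apply/asboolP.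
Qed.

End asymptotic_dimension.

(* Group ideals, for abelian groups written additively: A * B^-1 is A - B. *)
Record group_ideal (G : zmodType) := GroupIdeal {
  ideal_set :> set G -> Prop ;
  ideal_finite : forall A, finite_set A -> ideal_set A ;
  ideal_sub : forall A B, ideal_set A -> ideal_set B ->
    ideal_set [set a - b | a in A & b in B] ;
  ideal_subset : forall A C, ideal_set A -> C `<=` A -> ideal_set C }.

Section ideal_coarse.
Context {G : zmodType} (I : group_ideal G).
Implicit Types A B : set G.

(* {(x, y) : x \in A + y} together with the diagonal *)
Definition ideal_entourage A : set (G * G) :=
  [set xy | exists2 a, A a & xy.1 = a + xy.2] `|` diagonal.

Definition ideal_controlled : set (set (G * G)) :=
  [set E | exists2 A, I A & E `<=` ideal_entourage A].

Lemma ideal_opp A : I A -> I [set - a | a in A].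
Proof.
move=> IA; have I0 : I [set 0] by apply: ideal_finite.
apply: ideal_subset (ideal_sub I0 IA) _ => _ [a Aa <-].
by exists 0 => //; exists a => //; rewrite sub0r.
Qed.

Lemma ideal_add A B : I A -> I B -> I [set a + b | a in A & b in B].
Proof.
move=> IA IB; apply: ideal_subset (ideal_sub IA (ideal_opp IB)) _.
move=> _ [a Aa] [b Bb <-]; exists a => //; exists (- b); first by exists b.
by rewrite opprK.
Qed.

Lemma idealU A B : I A -> I B -> I (A `|` B).
Proof.
move=> IA IB.
have [->|/set0P[a Aa]] := eqVneq A set0; first by rewrite set0U.
have [->|/set0P[b Bb]] := eqVneq B set0; first by rewrite setU0.
have IF : I [set a; b] by apply: ideal_finite; exact: finite_set2.
apply: ideal_subset (ideal_sub (ideal_add IA IB) IF) _ => x [Ax|Bx].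
- exists (x + b); first by exists x => //; exists b.
  by exists b; [right|rewrite addrK].
- exists (a + x); first by exists a => //; exists x.
  by exists a; [left|rewrite addrC addKr].
Qed.

Lemma ideal_entourageS A B : A `<=` B ->
  ideal_entourage A `<=` ideal_entourage B.
Proof. by move=> AB xy [[a /AB Ba e]|d]; [left; exists a|right]. Qed.

Fact ideal_diagonal : ideal_controlled diagonal.
Proof. by exists set0; [exact: ideal_finite|right]. Qed.

Fact ideal_comp E E' : ideal_controlled E -> ideal_controlled E' ->
  ideal_controlled (E' \; E)%relation.
Proof.
move=> [A IA EA] [B IB EB].
exists ([set a + b | a in A & b in B] `|` (A `|` B)).
  by apply: idealU; [exact: ideal_add|exact: idealU].
move=> [x y] /= [z /EA/= xz /EB/= zy].
case: xz => [[a Aa /= xE]|]; last first.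
  rewrite /diagonal /= => ->.
  by apply: ideal_entourageS zy => b Bb; right; right.
case: zy => [[b Bb /= zE]|]; last first.
  rewrite /diagonal /= => <-.
  by left; exists a => //; right; left.
by left; exists (a + b); [left; exists a => //; exists b|rewrite /= xE zE addrA].
Qed.

Fact ideal_inv E : ideal_controlled E ->
  ideal_controlled (E^-1)%relation.
Proof.
move=> [A IA EA]; exists [set - a | a in A]; first exact: ideal_opp.
move=> [x y] /= /EA [[a Aa /= yE]|]; last by rewrite /diagonal /= => ->; right.
by left; exists (- a); [exists a|rewrite /= yE addKr].
Qed.

Fact ideal_controlledU E E' : ideal_controlled E -> ideal_controlled E' ->
  ideal_controlled (E `|` E').
Proof.
move=> [A IA EA] [B IB EB]; exists (A `|` B); first exact: idealU.
move=> xy [/EA|/EB]; apply: ideal_entourageS => c ?; [by left|by right].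
Qed.

Fact ideal_controlled_sub E H : ideal_controlled E -> H `<=` E ->
  ideal_controlled H.
Proof. by move=> [A IA EA] HE; exists A => //; exact: subset_trans HE EA. Qed.

Definition ideal_coarse : coarse_structure G :=
  CoarseStructure ideal_diagonal ideal_comp ideal_inv ideal_controlledU
    ideal_controlled_sub.

End ideal_coarse.

Section precompact_ideal.
Context {G : topologicalZmodType}.
Implicit Types A B K : set G.

Lemma compact_sub K L : compact K -> compact L ->
  compact [set a - b | a in K & b in L].
Proof.
move=> cK cL.
have -> : [set a - b | a in K & b in L] =
          (fun x : G * G => x.1 - x.2) @` (K `*` L).
  apply/seteqP; split=> [_ [a Ka] [b Lb <-]|_ [[a b] [/= Ka Lb] <-]].
    by exists (a, b).
  by exists a => //; exists b.
apply: continuous_compact; last exact: compact_setX.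
by apply: continuous_subspaceT => x; exact: sub_continuous.
Qed.

(* No separation axiom is needed. *)
Lemma compact_closure K : compact K -> compact (closure K).
Proof.
move=> cK F PF FK.
pose F' : set_system G :=
  filter_from [set AV : set G * set G | F AV.1 /\ nbhs 0 AV.2]
    (fun AV => K `&` [set a + v | a in AV.1 & v in AV.2]).
have PF' : ProperFilter F'.
  apply: filter_from_proper.
    apply: filter_from_filter; first by exists (setT, setT); split; exact: filterT.
    move=> [A V] [B W] /= [FA nV] [FB nW].
    exists (A `&` B, V `&` W); first by split; exact: filterI.
    move=> x [Kx /= [a [Aa Ba] [v [Vv Wv] xE]]].
    by split; split => //; exists a => //; exists v.
  move=> [A V] /= [FA nV].
  have [a [Aa cKa]] := filter_ex (filterI FA FK).
  have nVa : nbhs a [set x | V (x - a)].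
    have : (fun x : G => x - a) @ a --> a - a.
      apply: (@continuous_comp _ _ _ (fun x => (x, a)) (fun x : G * G => x.1 - x.2)).
        by apply: cvg_pair => /=; [exact: cvg_id|exact: cvg_cst].
      exact: sub_continuous.
    by rewrite subrr; apply.
  have [x [Kx Vxa]] := cKa _ nVa.
  by exists x; split => //; exists a => //; exists (x - a) => //; rewrite addrC subrK.
have F'K : F' K by exists (setT, setT); [split; exact: filterT|move=> x []].
have [x [Kx clx]] := cK F' PF' F'K.
exists x; split; first exact: subset_closure.
move=> A W FA nW.
have : (fun z : G * G => z.1 - z.2) @ (x, 0) --> x - 0.
  exact: (@sub_continuous G (x, 0)).
rewrite subr0 => /(_ W nW) [[U V] /= [nU nV] UVW].
have /clx /(_ nU) : F' (K `&` [set a + v | a in A & v in V]) by exists (A, V).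
move=> [y [[Ky [a Aa [v Vv yE]]] Uy]].
exists a; split => //.
by have := UVW (y, v) (conj Uy Vv); rewrite /= -yE addrK.
Qed.

Lemma compact_precompact_zmod A K : A `<=` K -> compact K -> precompact A.
Proof.
move=> AK cK; apply: precompact_subset AK _.
by rewrite precompactE; exact: compact_closure.
Qed.

Fact precompact_finite A : finite_set A -> precompact A.
Proof. by move=> /finite_compact; exact: compact_precompact_zmod. Qed.

Fact precompact_sub A B : precompact A -> precompact B ->
  precompact [set a - b | a in A & b in B].
Proof.
move=> [K AK [cK _]] [L BL [cL _]].
apply: compact_precompact_zmod (compact_sub cK cL) => _ [a Aa] [b Bb <-].
by exists a; [exact: AK|exists b => //; exact: BL].
Qed.

Fact precompact_subset_ideal A B : precompact A -> B `<=` A -> precompact B.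
Proof. by move=> pA BA; exact: precompact_subset BA pA. Qed.

End precompact_ideal.

(* [precompact A] is equivalent to [compact (closure A)], by [precompactE]. *)
Definition precompact_ideal (G : topologicalZmodType) : group_ideal G :=
  @GroupIdeal G (@precompact G) precompact_finite precompact_sub
    precompact_subset_ideal.

Definition metrizable (R : realType) (T : topologicalType) :=
  exists (M : metricType R) (f : T -> M) (g : M -> T),
    [/\ cancel f g, cancel g f, continuous f & continuous g].

Definition discrete (T : topologicalType) := forall A : set T, open A.

(* Main.v *)
Require Import Defs.
From mathcomp Require Import all_boot all_order all_algebra.
From mathcomp Require Import all_classical all_reals all_analysis.

(** Let K be a sequence of nonzero elements converging to 0, together with 0.
    It is precompact and has arbitrarily small nonzero elements.

    Given n, let D be the set of sums of n + 1 elements of K, which is again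
    precompact.  Suppose that G has a cover whose members are uniformly
    bounded and which splits into families N 0, ..., N n, each disjoint at the
    scale D - D.  A precompact C, depending on the bound, contains the
    difference of any two points of G that are D-near to the same member.
    The contradiction comes from a cubical grid in G, of dimension n + 1, whose
    unit cubes have D-small image and whose opposite faces are never congruent
    modulo C.

    The grid is a sum of n + 1 walks with steps in K.  One walk escapes from
    any precompact set while staying in any prescribed neighbourhood V of 0
    ([walk_escapes]): since K accumulates at 0, the set of endpoints of walks
    in V has no isolated point, and a countable compact space has no nonempty
    subset of that kind ([compact_perfect_uncountable], a Baire argument).
    This is where countability enters; in the real line, whose asymptotic
    dimension is 1, a walk in a bounded interval remains in a compact set.
    Choosing the walks one after the other, the new one escapes from all
    translates of C by the differences of the previous sums, and is so short
    that it cannot bring the previous ones back into C ([spreading_walks]).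

    Finally n + 1 families cannot cover such a grid.  For each direction i, call
    a grid point low if it lies on the face i = 0 or is near a member of N i
    that is also near a point of that face.  The face i = m has no low point by
    the choice of the walks.  By a discrete form of the Poincare-Miranda
    theorem ([discrete_Poincare_Miranda]) some unit cube contains, for every i
    at once, low and non-low points.  But its base point lies in a member of
    some N i, and disjointness then forces all its points to be low for i, or
    none. *)

Set Implicit Arguments.
Unset Strict Implicit.
Unset Printing Implicit Defensive.
Import Order.TTheory GRing.Theory Num.Theory.
Local Open Scope classical_set_scope.
Local Open Scope ring_scope.

(** * A discrete Poincare-Miranda theorem *)

Lemma addrr_F2 (x : 'F_2) : x + x = 0.
Proof. by apply: addrr_pchar2; rewrite pchar_Fp. Qed.

Section grid.
Context {I : finType}.
Implicit Types (u v w p : I -> nat) (i j l : I) (S : {set I}) (L : seq I).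

Definition step v j : I -> nat := fun i => (v i + (i == j))%N.

Definition update u j x : I -> nat := fun i => if i == j then x else u i.

Lemma stepC v i j : step (step v i) j = step (step v j) i.
Proof. by apply/funext => k; rewrite /step addnAC. Qed.

Lemma updateC u i j x y : i != j ->
  update (update u i x) j y = update (update u j y) i x.
Proof.
move=> ij; apply/funext => k; rewrite /update.
by case: (eqVneq k j) => [->|//]; rewrite eq_sym (negbTE ij).
Qed.

Lemma step_update u i j x : i != j ->
  step (update u i x) j = update (step u j) i x.
Proof.
move=> ij; apply/funext => k; rewrite /update /step.
by case: (eqVneq k i) => [->|//]; rewrite (negbTE ij) addn0.
Qed.

Lemma setD1C S i j : S :\ i :\ j = S :\ j :\ i.
Proof. by apply/setP => k; rewrite !inE andbCA. Qed.

Lemma exchange_pairs (T : nmodType) S (H : I -> I -> T) :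
  \sum_(i in S) \sum_(j in S :\ i) H i j =
  \sum_(j in S) \sum_(i in S :\ j) H i j.
Proof.
rewrite (exchange_big_dep [in S]) /=; last by move=> i j _ /setD1P[].
apply: eq_bigr => j jS; apply: eq_bigl => i.
by rewrite !inE jS andbT eq_sym andbC.
Qed.

(** Each unordered pair is counted twice. *)
Lemma sum_sym_pairs S (H : I -> I -> 'F_2) : (forall i j, H i j = H j i) ->
  \sum_(i in S) \sum_(j in S :\ i) H i j = 0.
Proof.
move=> Hsym.
pose lt i j := (enum_rank i < enum_rank j)%N.
have -> : \sum_(i in S) \sum_(j in S :\ i) H i j =
    \sum_(i in S) \sum_(j in S | lt i j) H i j +
    \sum_(i in S) \sum_(j in S | lt j i) H i j.
  rewrite -big_split /=; apply: eq_bigr => i iS.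
  rewrite (bigID (lt i)) /=; congr (_ + _); apply: eq_bigl => j; rewrite !inE /lt.
    case: eqVneq => [->|] /=; first by rewrite ltnn andbF.
    by [].
  rewrite -leqNgt [RHS]andbC leq_eqVlt (inj_eq val_inj) (inj_eq enum_rank_inj).
  by case: eqVneq => [->|] /=; rewrite ?ltnn // andbC.
rewrite [X in _ + X](exchange_big_dep [in S]) /=; last by move=> i j _ /andP[].
rewrite -[RHS](addrr_F2 (\sum_(i in S) \sum_(j in S | lt i j) H i j)).
congr (_ + _); apply: eq_bigr => i iS.
by apply: eq_big => [j|j _]; rewrite ?iS // andbC.
Qed.

Variable s : I -> (I -> nat) -> 'F_2.

(** The cup product of the coboundaries of the [s l], for [l] in [L], summed
    over the simplices of the Kuhn triangulation of the face of the unit cube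
    that starts at [v] and extends in the directions [S].  Such a simplex is a
    monotone path, whose k-th step is matched with the k-th entry of [L]. *)
Fixpoint cup L v S : 'F_2 :=
  if L is l :: L' then
    \sum_(j in S) (s l (step v j) + s l v) * cup L' (step v j) (S :\ j)
  else 1.

(** The product is a closed cochain.  Here [L] is one shorter than a path, and
    closedness, summed over all paths of one cube, compares the facets that
    omit the first vertex with those that omit the last one: the facets that
    omit an inner vertex cancel in pairs, by exchanging two steps. *)
Lemma cup_facets L v S :
  \sum_(j in S) cup L (step v j) (S :\ j) = \sum_(j in S) cup L v (S :\ j).
Proof.
elim: L v S => [//|l L IH] v S /=.
pose T i j := cup L (step (step v i) j) (S :\ i :\ j).
have Tsym i j : T i j = T j i by rewrite /T stepC setD1C.
transitivity (\sum_(j in S) \sum_(i in S :\ j) s l (step v j) * T j i).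
  transitivity (\sum_(j in S) \sum_(i in S :\ j) s l (step (step v j) i) * T j i +
    \sum_(j in S) \sum_(i in S :\ j) s l (step v j) * T j i).
    rewrite -big_split; apply: eq_bigr => j _; rewrite -big_split.
    by apply: eq_bigr => i _; rewrite mulrDl.
  rewrite sum_sym_pairs ?add0r// => i j.
  by rewrite Tsym stepC.
rewrite [RHS]exchange_pairs.
transitivity (\sum_(j in S) \sum_(i in S :\ j) s l (step v j) * T j i +
              \sum_(j in S) \sum_(i in S :\ j) s l v * T j i).
  by rewrite [X in _ + X]sum_sym_pairs ?addr0// => i j; rewrite Tsym.
rewrite -big_split; apply: eq_bigr => j _.
rewrite -big_split /=; under eq_bigr do rewrite -mulrDl.
rewrite -mulr_sumr /T (IH (step v j) (S :\ j)) mulr_sumr.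
by apply: eq_bigr => i _; rewrite setD1C.
Qed.

(** The coboundary of a function vanishes along a face on which the function is
    constant. *)
Lemma cup_flat L v S i : i \in L -> i \notin S ->
  (forall w, w i = v i -> s i w = s i v) -> cup L v S = 0.
Proof.
elim: L v S => [//|l L IH] v S; rewrite inE => iL iS cst /=.
apply: big1 => j jS.
have vj : step v j i = v i.
  rewrite /step; case: eqVneq => [ij|]; last by rewrite addn0.
  by move: iS; rewrite ij jS.
case/orP: iL => [/eqP<-|iL]; first by rewrite cst// addrr_F2 mul0r.
rewrite IH ?mulr0// ?inE ?(negbTE iS) ?andbF// => w wi.
by rewrite !cst// wi.
Qed.

(** A nonzero product has a simplex along which every [s l] changes. *)
Lemma cup_neq0 L v S : cup L v S != 0 -> forall l, l \in L ->
  exists w w', [/\ forall i, (v i <= w i <= v i + (i \in S))%N,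
    forall i, (v i <= w' i <= v i + (i \in S))%N & s l w != s l w'].
Proof.
elim: L v S => [//|k L IH] v S /= nz l.
have [j jS nzj] : exists2 j, j \in S &
    (s k (step v j) + s k v) * cup L (step v j) (S :\ j) != 0.
  apply/exists_inP; apply: contraNT nz; rewrite negb_exists_in => /forall_inP h.
  by apply/eqP/big1 => j /h; rewrite negbK => /eqP.
move: nzj; rewrite mulf_eq0 negb_or => /andP[nzk nzL].
rewrite inE => /orP[/eqP->|lL].
  exists (step v j), v; split.
  - move=> i; rewrite /step leq_addr leq_add2l.
    by case: eqVneq => [->|//]; rewrite jS.
  - by move=> i; rewrite leqnn leq_addr.
  - by apply: contraNneq nzk => ->; rewrite addrr_F2.
have sub w : (forall i, (step v j i <= w i <= step v j i + (i \in S :\ j))%N) ->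
    forall i, (v i <= w i <= v i + (i \in S))%N.
  move=> h i; move: (h i); rewrite /step !inE => /andP[h1 h2].
  rewrite (leq_trans (leq_addr _ _) h1) (leq_trans h2)//.
  rewrite -addnA leq_add2l.
  by case: eqVneq => [->|] /=; rewrite ?jS.
have [w [w' [/sub hw /sub hw' ne]]] := IH _ _ nzL _ lL.
by exists w, w'.
Qed.

Variable m : nat.

Fixpoint box_sum L u (g : (I -> nat) -> 'F_2) : 'F_2 :=
  if L is l :: L' then \sum_(x < m) box_sum L' (update u l x) g else g u.

Lemma eq_box_sum L u g g' :
  (forall p, (forall i, i \notin L -> p i = u i) -> g p = g' p) ->
  box_sum L u g = box_sum L u g'.
Proof.
elim: L u => [|l L IH] u h /=; first exact: h.
apply: eq_bigr => x _; apply: IH => p pu; apply: h => i.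
rewrite inE negb_or => /andP[il iL].
by rewrite pu// /update (negbTE il).
Qed.

Lemma box_sum0 L u : box_sum L u (fun=> 0) = 0.
Proof. by elim: L u => [//|l L IH] u /=; apply: big1. Qed.

Lemma box_sumD L u g h :
  box_sum L u (fun p => g p + h p) = box_sum L u g + box_sum L u h.
Proof.
elim: L u => [//|l L IH] u /=.
by under eq_bigr do rewrite IH; rewrite big_split.
Qed.

Lemma box_sum_sum L u S (g : I -> (I -> nat) -> 'F_2) :
  box_sum L u (fun p => \sum_(j in S) g j p) = \sum_(j in S) box_sum L u (g j).
Proof.
elim: L u => [//|l L IH] u /=.
by under eq_bigr do rewrite IH; rewrite exchange_big.
Qed.

Lemma box_sum_neq0 L u g : box_sum L u g != 0 -> exists p, g p != 0.
Proof.
move=> nz; apply: contrapT => h; move: nz; apply/negP; rewrite negbK.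
rewrite -(box_sum0 L u); apply/eqP/eq_box_sum => p _.
by apply/eqP; apply: contrapT => /negP hp; apply: h; exists p.
Qed.

Lemma box_sum_step L u j g : j \notin L ->
  box_sum L u (fun p => g (step p j)) = box_sum L (step u j) g.
Proof.
elim: L u => [//|l L IH] u /=; rewrite inE negb_or => /andP[jl jL].
by apply: eq_bigr => x _; rewrite IH// step_update// eq_sym.
Qed.

(** The discrete fundamental theorem of calculus in direction [j]. *)
Lemma box_sum_telescope L u j g : uniq L -> j \in L ->
  box_sum L u (fun p => g (step p j) + g p) =
  box_sum (rem j L) (update u j m) g + box_sum (rem j L) (update u j 0%N) g.
Proof.
elim: L u => [//|l L IH] u /= /andP[lL uL]; rewrite inE.
case: (eqVneq l j) => [lj _|lj].
  rewrite -{}lj in lL *.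
  have E x : box_sum L (update u l x) (fun p => g (step p l) + g p) =
      box_sum L (update u l x.+1) g + box_sum L (update u l x) g.
    rewrite box_sumD box_sum_step//; congr (box_sum _ _ _ + _).
    apply/funext => i; rewrite /step /update.
    by case: eqVneq => _; rewrite ?addn1 ?addn0.
  under eq_bigr do rewrite E.
  elim: m => [|k IHk]; first by rewrite big_ord0 addrr_F2.
  by rewrite big_ord_recr /= IHk addrAC addrCA addrr_F2 addr0.
move=> /= jL.
under eq_bigr do rewrite IH//.
rewrite big_split /=; congr (_ + _);
by apply: eq_bigr => x _; rewrite updateC// eq_sym.
Qed.

(** Stokes' formula, by induction on the dimension.  By [cup_facets] the
    integral of the coboundary of [s l] times a closed form is a sum of boundary
    terms, one for each direction [j].  For [j] other than [l] they vanish,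
    because [s j] is constant on the two faces; for [j = l] only the face
    where [s l = 1] contributes, and its contribution is the integral in one
    dimension less. *)
Lemma box_sum_cup L u : uniq L ->
  (forall i p, i \in L -> p i = 0%N -> s i p = 0) ->
  (forall i p, i \in L -> p i = m -> s i p = 1) ->
  box_sum L u (fun p => cup L p [set i in L]%SET) = 1.
Proof.
elim: L u => [//|l L IH] u uL s0 s1.
have /andP[lL uL'] : (l \notin L) && uniq L := uL.
set S := [set i in l :: L]%SET.
pose g j p := s l p * cup L p (S :\ j).
have flat j p : j \in L -> p j = 0%N \/ p j = m -> g j p = 0.
  move=> jL pj; rewrite /g (@cup_flat _ _ _ j) ?mulr0// ?inE ?eqxx// => w wj.
  have jlL : j \in l :: L by rewrite inE jL orbT.
  by case: pj => pj; [rewrite !s0// wj|rewrite !s1// wj].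
rewrite (@eq_box_sum (l :: L) u _ (fun p => \sum_(j in S) (g j (step p j) + g j p))).
  rewrite box_sum_sum.
  rewrite (eq_bigr (fun j => box_sum (rem j (l :: L)) (update u j m) (g j) +
      box_sum (rem j (l :: L)) (update u j 0%N) (g j))); last first.
    by move=> j; rewrite inE => jL; exact: box_sum_telescope.
  rewrite (bigD1 l); last by rewrite !inE eqxx.
  rewrite [X in _ + X = _]big1 ?addr0 => [|j /andP[]].
    have -> : rem l (l :: L) = L by rewrite /= eqxx.
    rewrite [X in _ + X = _](_ : _ = 0) ?addr0; last first.
      rewrite -(box_sum0 L (update u l 0%N)); apply: eq_box_sum => p pu.
      by rewrite /g s0 ?mul0r ?mem_head// pu// /update eqxx.
    have <- : box_sum L (update u l m) ((cup L)^~ [set i in L]%SET) = 1.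
      by apply: IH => // i p iL; [apply: s0|apply: s1]; rewrite inE iL orbT.
    apply: eq_box_sum => p pu.
    rewrite /g s1 ?mem_head ?mul1r//; last by rewrite pu// /update eqxx.
    congr cup; apply/setP => i; rewrite !inE.
    by have [->|//] := eqVneq i l; rewrite (negbTE lL).
  rewrite inE => jlL jl; move: (jlL); rewrite inE (negbTE jl) /= => jL.
  have nj : j \notin rem j (l :: L) by rewrite mem_rem_uniqF.
  rewrite -[RHS](addrr_F2 0); congr (_ + _).
  - rewrite -(box_sum0 (rem j (l :: L)) (update u j m)).
    apply: eq_box_sum => p pu; apply: flat => //; right.
    by rewrite pu// /update eqxx.
  - rewrite -(box_sum0 (rem j (l :: L)) (update u j 0%N)).
    apply: eq_box_sum => p pu; apply: flat => //; left.
    by rewrite pu// /update eqxx.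
move=> p _ /=; rewrite big_split /=.
under eq_bigr do rewrite mulrDl.
rewrite big_split /=; congr (_ + _).
by rewrite -mulr_sumr cup_facets mulr_sumr.
Qed.
End grid.

(** By [box_sum_cup] the product of the coboundaries has integral 1 over the box,
    so it is nonzero on some unit cube. *)
Theorem discrete_Poincare_Miranda (I : finType) (m : nat)
    (s : I -> (I -> nat) -> bool) :
  (forall i p, p i = 0%N -> s i p = false) ->
  (forall i p, p i = m -> s i p = true) ->
  exists p : I -> nat, forall i, exists w w' : I -> nat,
    [/\ forall j, (p j <= w j <= (p j).+1)%N,
        forall j, (p j <= w' j <= (p j).+1)%N & s i w != s i w'].
Proof.
move=> s0 s1; pose t i p : 'F_2 := (s i p)%:R.
have /box_sum_neq0[p] :
    box_sum m (enum I) (fun=> 0%N) (fun p => cup t (enum I) p [set i in enum I]%SET) != 0.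
  rewrite box_sum_cup ?enum_uniq ?oner_eq0// /t => i p _ pi.
    by rewrite s0.
  by rewrite s1.
move=> /cup_neq0 h; exists p => i.
have [w [w' [hw hw' ne]]] := h i (mem_enum _ _).
exists w, w'; split=> [j|j|].
- by have := hw j; rewrite inE mem_enum addn1.
- by have := hw' j; rewrite inE mem_enum addn1.
- by apply: contra ne => /eqP; rewrite /t => ->.
Qed.

(** * Countable compact sets *)

(** The closure of [P] would be a compact set without isolated points.  The
    proof shrinks open sets that meet [P] so as to avoid the points of [C] one
    after the other, and takes a cluster point in [C] of the resulting
    sequence. *)
Lemma compact_perfect_uncountable (T : topologicalType) (C P : set T) :
  hausdorff_space T -> regular_space T -> compact C -> P `<=` C -> P !=set0 ->
  (forall x U, P x -> nbhs x U -> exists y, [/\ P y, U y & y <> x]) ->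
  ~ countable C.
Proof.
move=> hT rT cC PC [x0 Px0] perf /countable_injP[c cinj].
pose open_meeting := {O : set T | open O /\ exists2 x, P x & O x}.
have avoid (k : nat) (O : open_meeting) : exists O' : open_meeting,
    closure (sval O') `<=` sval O /\
    forall y, C y -> c y = k -> ~ closure (sval O') y.
  case: O => O [oO [x Px Ox]] /=.
  have [z [Pz Oz czk]] : exists z, [/\ P z, O z & c z <> k].
    have [cxk|cxk] := eqVneq (c x) k; last by exists x; split=> //; exact/eqP.
    have [y [Py Oy yx]] := perf x O Px (open_nbhs_nbhs (conj oO Ox)).
    exists y; split=> // cyk; apply: yx; apply: cinj; rewrite ?cyk//.
    - by apply/mem_set/PC.
    - by apply/mem_set/PC.
  have nU : nbhs z (O `&` [set y | ~ (C y /\ c y = k)]).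
    apply: filterI; first exact: open_nbhs_nbhs.
    have [[g [Cg cgk]]|nog] := pselect (exists g, C g /\ c g = k).
      have gz : z != g by apply/eqP => zg; apply: czk; rewrite zg.
      have : nbhs z (~` [set g]).
        apply: open_nbhs_nbhs; split; last by move=> /= zg; move/eqP: gz.
        apply: closed_openC; apply: accessible_closed_set1.
        exact: hausdorff_accessible.
      apply: filterS => y /= yg [Cy cyk]; apply: yg.
      by apply: cinj; rewrite ?cyk//; exact: mem_set.
    by apply: (@filterS _ _ _ setT); [move=> y _ h; apply: nog; exists y|exact: filterT].
  have [V nV VU] := rT z _ nU.
  have clV : closure V° `<=` closure V by apply: closureS; exact: interior_subset.
  have pV : open V° /\ exists2 x, P x & V° x.
    by split; [exact: open_interior|exists z].
  exists (exist _ V° pV); split=> [y /clV/VU[]//|y Cy cyk /clV/VU[_]].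
  exact.
pose F k O := projT1 (cid (avoid k O)).
have FO k O : closure (sval (F k O)) `<=` sval O by have [] := projT2 (cid (avoid k O)).
have Fk k O y : C y -> c y = k -> ~ closure (sval (F k O)) y.
  by have [_] := projT2 (cid (avoid k O)); exact.
have pT : open (@setT T) /\ exists2 x, P x & @setT T x.
  by split; [exact: openT|exists x0].
pose O := fix O k : open_meeting := if k is k'.+1 then F k' (O k') else exist _ setT pT.
have Odecr i j : (i <= j)%N -> sval (O j) `<=` sval (O i).
  elim: j => [|j IH]; first by rewrite leqn0 => /eqP->.
  rewrite leq_eqVlt => /orP[/eqP->//|]; rewrite ltnS => /IH.
  by apply: subset_trans => y Oy; apply: (FO j); exact: subset_closure.
pose FF := filter_from [set: nat] (fun k => C `&` sval (O k)).
have PF : ProperFilter FF.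
  apply: filter_from_proper.
    apply: filter_from_filter; first by exists 0%N.
    move=> i j _ _; exists (maxn i j) => // y [Cy Oy].
    by split; split=> //; apply: Odecr Oy; rewrite ?leq_maxl ?leq_maxr.
  by move=> i _; case: (O i) => /= U [_ [x Px Ux]]; exists x; split=> //; exact: PC.
have [y [Cy cly]] : C `&` cluster FF !=set0 by apply: cC; exists 0%N => // y [].
apply: (Fk (c y) (O (c y)) y) => // W nW.
have [|z [[Cz Oz] Wz]] := cly (C `&` sval (O (c y).+1)) W _ nW.
  by exists (c y).+1.
by exists z.
Qed.

(** * Walks with steps in a null sequence *)

Section topological_group.
Context {G : topologicalZmodType}.
Implicit Types (K C V W : set G) (g h : G).

Lemma nbhs_sub g h V : nbhs (g - h) V ->
  exists U W, [/\ nbhs g U, nbhs h W & forall a b, U a -> W b -> V (a - b)].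
Proof.
move=> /(@sub_continuous G (g, h))[[U W] /= [nU nW] UWV].
by exists U, W; split=> // a b Ua Wb; exact: (UWV (a, b)).
Qed.

Lemma nbhs_add g h V : nbhs (g + h) V ->
  exists U W, [/\ nbhs g U, nbhs h W & forall a b, U a -> W b -> V (a + b)].
Proof.
move=> /(@add_continuous G (g, h))[[U W] /= [nU nW] UWV].
by exists U, W; split=> // a b Ua Wb; exact: (UWV (a, b)).
Qed.

Lemma nondiscrete_nbhs0 V : ~ discrete G -> nbhs 0 V -> exists2 g, V g & g != 0.
Proof.
move=> nd nV; apply: contrapT => h; apply: nd => A.
rewrite openE => x Ax; rewrite /interior.
have : nbhs (x - x) V by rewrite subrr.
move=> /nbhs_sub[U [W [nU nW UWV]]].
apply: filterS nU => a Ua.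
have Vax : V (a - x) by apply: UWV => //; exact: nbhs_singleton.
have [/eqP|ax] := eqVneq (a - x) 0; last by exfalso; apply: h; exists (a - x).
by rewrite subr_eq0 => /eqP->.
Qed.

Lemma null_sequence (R : realType) : ~ discrete G -> metrizable R G ->
  exists a : nat -> G, (forall k, a k != 0) /\ a @ \oo --> (0 : G).
Proof.
move=> nd [M [f [g [fK gK cf cg]]]].
have nb k : nbhs (0:G) (f @^-1` ball (f 0) k.+1%:R^-1).
  by apply: cf; apply: nbhsx_ballx; rewrite invr_gt0 ltr0n.
have sel k : exists x : G, ball (f 0) k.+1%:R^-1 (f x) /\ x != 0.
  by have [x Vx x0] := nondiscrete_nbhs0 nd (nb k); exists x.
have [a ha] := choice sel; exists a; split=> [k|]; first by case: (ha k).
move=> V; rewrite -{1}(fK 0) => /cg/nbhs_ballP[e /= e0 eV].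
have [N _ hN] := near_infty_natSinv_lt (PosNum e0).
exists N => // k Nk /=; rewrite -(fK (a k)); apply: eV.
apply: le_ball (proj1 (ha k)).
exact: ltW (hN k Nk).
Qed.

Lemma precompact_null_sequence (a : nat -> G) : a @ \oo --> (0 : G) ->
  precompact (0 |` range a).
Proof.
move=> a0; apply: (@compact_precompact_zmod _ _ (0 |` range a)) => // F PF FK.
have [cl0|] := pselect (cluster F 0); first by exists 0; split=> //; left.
move=> /existsNP[A] /existsNP[V] /not_implyP[FA] /not_implyP[nV AV].
have [N _ hN] := a0 V nV.
have fin : finite_set (a @` `I_N) by apply: finite_image; exact: finite_II.
have [|x [[k _ <-] clx]] := finite_compact fin PF.
  apply: filterS (filterI FA FK) => x [Ax xK].
  have nVx : ~ V x by move=> Vx; apply: AV; exists x.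
  case: xK => [x0|[k _ akx]].
    by exfalso; apply: nVx; rewrite x0; exact: nbhs_singleton.
  exists k => //=; rewrite ltnNge; apply/negP => Nk; apply: nVx.
  by rewrite -akx; exact: hN.
by exists (a k); split=> //; right; exists k.
Qed.

(** Walks are infinite sequences that stop moving at time [m], so that walks of
    different lengths can be run together. *)
Definition walk K (gamma : nat -> G) (m : nat) :=
  [/\ gamma 0%N = 0, forall t, K (gamma t.+1 - gamma t) &
      forall t, gamma t = gamma (minn t m)].

Lemma walk_extend K gamma m g : K 0 -> walk K gamma m -> K g ->
  exists gamma', [/\ walk K gamma' m.+1, gamma' m.+1 = gamma m + g &
    forall t, gamma' t = gamma m + g \/ gamma' t = gamma t].
Proof.
move=> K0 [g0 gK gc] Kg.
exists (fun t => if (t <= m)%N then gamma t else gamma m + g); split.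
- split=> // t.
  + have [tm|mt] := ltnP t m; first by rewrite ltnW// gK.
    case: (ltngtP t m) mt => // [mt _|-> _]; first by rewrite subrr.
    by rewrite addrC addKr.
  + have [tm|mt] := leqP t m; first by rewrite (minn_idPl (leqW tm)) tm.
    by rewrite (minn_idPr mt) ltnn.
- by rewrite ltnn.
- by move=> t; case: ifP => _; [right|left].
Qed.

Lemma walk_weaken K gamma m m' : (m <= m')%N -> walk K gamma m -> walk K gamma m'.
Proof.
move=> mm' [g0 gK gc]; split=> // t.
by rewrite gc [RHS]gc -minnA (minn_idPr mm').
Qed.

(** Inside the interior of [V] every endpoint of a walk is a limit of endpoints
    of walks that make one more small step.  The endpoints therefore form a
    set without isolated points, and it cannot be contained in the countable
    compact set [closure C]. *)
Lemma walk_escapes (R : realType) K C V :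
  metrizable R G -> countable [set: G] ->
  K 0 -> (forall W, nbhs 0 W -> exists g, [/\ K g, W g & g != 0]) ->
  precompact C -> nbhs 0 V ->
  exists gamma m, [/\ walk K gamma m, forall t, V (gamma t) & ~ C (gamma m)].
Proof.
move=> [M [f [g [fK gK cf cg]]]] cG K0 Ksmall pC nV.
apply: contrapT => trapped.
pose P := [set x | exists gamma m,
  [/\ walk K gamma m, forall t, V° (gamma t) & gamma m = x]].
have PC : P `<=` C.
  move=> _ [gamma [m [wg Vg <-]]]; apply: contrapT => nC; apply: trapped.
  by exists gamma, m; split=> // t; exact: interior_subset.
have cC : compact (f @` closure C).
  apply: continuous_compact; last by rewrite -precompactE.
  exact: continuous_subspaceT.
(* In the metric space, regularity and separation are available. *)
apply: (compact_perfect_uncountable _ _ cC (P := f @` P)).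
- exact: metric_hausdorff.
- exact: uniform_regular.
- by move=> _ [x /PC Cx <-]; exists x => //; exact: subset_closure.
- exists (f 0), 0 => //; exists (fun=> 0), 0%N; split=> [|t|//].
    by split=> // t; rewrite subrr.
  exact: nV.
- move=> _ U [x [gamma [m [wg Vg gx]]] <-] /cf nU.
  have nx : nbhs (x + 0) (f @^-1` U `&` V°).
    rewrite addr0; apply: filterI => //; apply: nbhs_interior.
    by rewrite -gx; exact: Vg.
  have [A [B [nA nB AB]]] := nbhs_add nx.
  have [h [Kh Bh h0]] := Ksmall B nB.
  have [Ufxh Vxh] := AB x h (nbhs_singleton nA) Bh.
  exists (f (x + h)); split=> //.
    exists (x + h) => //.
    have [gamma' [wg' gx' gt]] := walk_extend K0 wg Kh.
    exists gamma', m.+1; split=> // [t|]; last by rewrite gx' gx.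
    by have [->|->] := gt t; rewrite ?gx.
  move=> /(can_inj fK) /eqP; rewrite -subr_eq0 addrC addKr.
  exact/negP.
- exact: sub_countable (card_image_le _ _) (sub_countable (subset_card_le (@subsetT _ _)) cG).
Qed.
End topological_group.

(** * Grids with distant opposite faces *)

Section walks.
Context {R : realType} {G : topologicalZmodType}.
Variable K : set G.
Hypotheses (G_countable : countable [set: G]) (G_metrizable : metrizable R G).
Hypotheses (K0 : K 0)
  (Ksmall : forall W, nbhs 0 W -> exists g, [/\ K g, W g & g != 0]).

Definition grid_point n (gamma : nat -> nat -> G) (p : nat -> nat) : G :=
  \sum_(j < n) gamma j (p j).

(** The walks are built one at a time.  Only finitely many sums of the walks
    built so far exist.  So there is a neighbourhood [W] of 0 such that
    perturbing a difference of two sums by [W - W] does not bring it into the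
    closed set [C] from outside: a new walk in [W] preserves what is known of
    the previous ones.  By [walk_escapes] it can be taken to end outside of
    [C - T], with [T] the finite set of these differences, as its own
    direction requires. *)
Lemma spreading_walks (C : set G) n : closed C -> precompact C ->
  exists (gamma : nat -> nat -> G) (m : nat),
    (forall j, (j < n)%N -> walk K (gamma j) m) /\
    forall p q i, (i < n)%N -> p i = m -> q i = 0%N ->
      ~ C (grid_point n gamma p - grid_point n gamma q).
Proof.
move=> clC pC.
suff : exists (gamma : nat -> nat -> G) (m : nat),
    [/\ forall j, (j < n)%N -> walk K (gamma j) m,
        finite_set (range (grid_point n gamma)) &
        forall p q i, (i < n)%N -> p i = m -> q i = 0%N ->
          ~ C (grid_point n gamma p - grid_point n gamma q)].
  by move=> [gamma [m [wg _ gC]]]; exists gamma, m.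
elim: n => [|n [gamma [m [wg fin gC]]]].
  exists (fun _ _ => 0), 0%N; split=> //.
  apply: (@sub_finite_set _ _ [set 0]) => // _ [p _ <-].
  by rewrite /grid_point big_ord0.
set S := range (grid_point n gamma) in fin.
pose T := [set a - b | a in S & b in S].
have finT : finite_set T by exact: finite_image2.
have [W nW WC] : exists2 W, nbhs 0 W & forall t r r', T t -> ~ C t ->
    W r -> W r' -> ~ C (t + (r - r')).
  have Wt t : exists W, nbhs 0 W /\
      forall r r', ~ C t -> W r -> W r' -> ~ C (t + (r - r')).
    have [Ct|nCt] := pselect (C t); first by exists setT; split=> //; exact: filterT.
    have : nbhs (t + (0 - 0)) (~` C).
      by apply: open_nbhs_nbhs; split; [exact: closed_openC|rewrite subr0 addr0].
    move=> /nbhs_add[A [B [nA nB AB]]].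
    have [U [V [nU nV UV]]] := nbhs_sub nB.
    exists (U `&` V); split; first exact: filterI.
    by move=> r r' _ [Ur _] [_ Vr']; apply: AB (nbhs_singleton nA) (UV _ _ Ur Vr').
  have [W hW] := choice Wt; exists (\bigcap_(t in T) W t).
    have [X ->] := finite_fsetP.1 finT.
    by apply: filter_bigI => t _; case: (hW t).
  by move=> t r r' Tt nCt Wr Wr'; apply: (proj2 (hW t)) => //; [exact: Wr|exact: Wr'].
have pC2 : precompact [set c - t | c in C & t in T].
  by apply: precompact_sub => //; exact: precompact_finite.
have [delta [k [wd Wd dC]]] := walk_escapes G_metrizable G_countable K0 Ksmall pC2 nW.
pose gamma' j := if j == n then delta else gamma j.
have gridS p : grid_point n.+1 gamma' p = grid_point n gamma p + delta (p n).
  rewrite /grid_point big_ord_recr /= /gamma' eqxx; congr (_ + _).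
  by apply: eq_bigr => j _; rewrite ltn_eqF.
have ST p q : T (grid_point n gamma p - grid_point n gamma q).
  by exists (grid_point n gamma p); [exists p|exists (grid_point n gamma q) => //; exists q].
exists gamma', (maxn m k); split.
- move=> j; rewrite ltnS leq_eqVlt /gamma' => /orP[/eqP->|jn].
    by rewrite eqxx; apply: walk_weaken wd; exact: leq_maxr.
  by rewrite ltn_eqF//; apply: walk_weaken (wg _ jn); exact: leq_maxl.
- apply: (@sub_finite_set _ _ [set a + b | a in S & b in range delta]).
    move=> _ [p _ <-]; rewrite gridS; exists (grid_point n gamma p); first by exists p.
    by exists (delta (p n)) => //; exists (p n).
  apply: finite_image2 => //.
  apply: (@sub_finite_set _ _ (delta @` `I_k.+1)).
    have [_ _ dk] := wd.
    by move=> _ [t _ <-]; exists (minn t k); [rewrite /= ltnS geq_minr|rewrite -dk].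
  by apply: finite_image; exact: finite_II.
- move=> p q i; rewrite ltnS leq_eqVlt !gridS opprD addrACA => /orP[/eqP->|ilt] pi qi.
    have [d0 _ dk] := wd.
    have -> : delta (p n) = delta k by rewrite pi dk (minn_idPr (leq_maxr _ _)).
    rewrite qi d0 subr0 => Cpq; apply: dC.
    by eexists; first exact: Cpq; eexists; first exact: ST p q; rewrite [X in X - _]addrC addrK.
  apply: WC => //.
  (* The face at distance [maxn m k] in direction [i] carries the same points
     as the face at distance [m], where the [i]-th walk stops. *)
  pose p' j := minn (p j) m.
  have -> : grid_point n gamma p = grid_point n gamma p'.
    by apply: eq_bigr => j _; have [_ _] := wg j (ltn_ord j).
  apply: gC ilt _ qi.
  by rewrite /p' pi (minn_idPr (leq_maxl _ _)).
Qed.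

Lemma precompact_sums n : precompact K ->
  precompact [set g | exists2 e : nat -> G, (forall j, K (e j)) & g = \sum_(j < n) e j].
Proof.
move=> pK; elim: n => [|n IH].
  apply: (@precompact_subset _ _ [set 0]); last exact: precompact_finite.
  by move=> _ [e _ ->]; rewrite big_ord0.
apply: precompact_subset (@ideal_add _ (precompact_ideal G) _ _ IH pK).
move=> _ [e Ke ->]; rewrite big_ord_recr /=.
by exists (\sum_(j < n) e j); [exists e|exists (e n)].
Qed.
End walks.

(** * The asymptotic dimension *)

Theorem theorem3 (R : realType) (G : topologicalZmodType)
  (G_nondiscrete : ~ discrete G)
  (G_countable : countable [set: G])
  (G_metrizable : metrizable R G) :
  asdim (ideal_coarse (precompact_ideal G)) = +oo%E.
Proof.
have [a [a_neq0 a_cvg0]] := null_sequence G_nondiscrete G_metrizable.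
pose K := 0 |` range a.
have K0 : K 0 by left.
have pK : precompact K := precompact_null_sequence a_cvg0.
have Ksmall W : nbhs 0 W -> exists g, [/\ K g, W g & g != 0].
  move=> /a_cvg0[N _ hN]; exists (a N); split=> //; first by right; exists N.
  exact: (hN N (leqnn N)).
apply/asdim_pinftyP => n asdim_le_n.
pose I := precompact_ideal G.
pose D := [set g | exists2 e : nat -> G, (forall j, K (e j)) & g = \sum_(j < n.+1) e j].
have pD : I D := precompact_sums n.+1 pK.
have D0 : D 0 by exists (fun=> 0) => //; rewrite big1.
(* The scale is [D - D] because two members that are D-near to the same point
   have elements that differ by an element of [D - D]. *)
have cE : ideal_coarse I (ideal_entourage [set a - b | a in D & b in D]).
  by exists [set a - b | a in D & b in D] => //; exact: ideal_sub.
have [F [B pB FB] [M [Mcov Mbd [N [MN _ Ndisj]]]]] := asdim_le_n _ cE.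
pose near_set A g := exists2 b, A b & D (g - b).
pose B0 := 0 |` B.
pose C := [set x - y | x in [set x + y | x in D & y in [set x - y | x in B0 & y in B0]] & y in D].
have pB0 : I B0 by apply: idealU => //; apply: ideal_finite; exact: finite_set1.
have pC : I C.
  by apply: ideal_sub => //; apply: ideal_add => //; exact: ideal_sub.
have C0 : C 0.
  exists 0; last by exists 0 => //; rewrite subr0.
  exists 0 => //; exists 0; last by rewrite addr0.
  by exists 0; [left|exists 0; [left|rewrite subr0]].
have near_diff A g h : M A -> near_set A g -> near_set A h -> C (g - h).
  move=> /Mbd[x Ax] [b Ab Dgb] [c Ac Dhc].
  have AB0 y : A y -> B0 (x - y).
    move=> /Ax; rewrite /xsection /= inE => /FB[[z Bz xE]|xE].
      by right; rewrite (xE : x = z + y) addrK.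
    by left; rewrite (xE : x = y) subrr.
  exists (g - b + (b - c)).
    exists (g - b) => //; exists (b - c) => //.
    exists (x - c); [exact: AB0|exists (x - b); [exact: AB0|]].
    by rewrite opprB addrC addrA subrK.
  exists (h - c) => //.
  by rewrite opprB !addrA !subrK.
have pclC : precompact (closure C).
  by rewrite precompact_closed; [rewrite -precompactE|exact: closed_closure].
have [gamma [m [wg gC]]] :=
  spreading_walks G_countable G_metrizable K0 Ksmall n.+1 (@closed_closure _ C) pclC.
pose x (p : 'I_n.+1 -> nat) := grid_point n.+1 gamma (fun j => p (inord j)).
have xC p q i : p i = m -> q i = 0%N -> ~ C (x p - x q).
  move=> pi qi Cpq; apply: (gC (fun j => p (inord j)) (fun j => q (inord j)) i) => //.
  - by rewrite inord_val.
  - by rewrite inord_val.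
  - exact: subset_closure.
have m0 : m <> 0%N.
  by move=> m0; apply: (xC (fun=> 0%N) (fun=> 0%N) ord0) => //; rewrite subrr.
have xD p w : (forall j, p j <= w j <= (p j).+1)%N -> D (x w - x p).
  move=> pw; exists (fun j => if (j < n.+1)%N then
      gamma j (w (inord j)) - gamma j (p (inord j)) else 0).
    move=> j; case: ltnP => // jn; have [_ gK _] := wg j jn.
    have := pw (inord j); case: (ltngtP (w (inord j)) (p (inord j)).+1) => //.
    - rewrite ltnS => h1 /andP[h2 _].
      have -> : w (inord j) = p (inord j) by apply/eqP; rewrite eqn_leq h1 h2.
      by rewrite subrr.
    - by move=> _ /andP[].
    - by move=> ->.
  rewrite /x /grid_point -sumrB; apply: eq_bigr => j _.
  by rewrite ltn_ord.
(* The low points for [i] are the linked ones and those of the face [p i = 0]. *)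
pose linked i p := exists A, [/\ N i A, near_set A (x p) &
  exists2 q, q i = 0%N & near_set A (x q)].
have [||p hp] := @discrete_Poincare_Miranda 'I_n.+1 m
  (fun i p => (p i != 0%N) && ~~ `[< linked i p >]).
- by move=> i p ->.
- move=> i p pi; rewrite pi; apply/andP; split; first exact/eqP.
  apply/asboolP => -[A [NA Ap [q qi Aq]]].
  apply: (xC p q i) => //; apply: near_diff Ap Aq.
  by rewrite MN; exists i.
have [A MA Axp] : (\bigcup_(A in M) A) (x p) by rewrite Mcov.
have [i _ NA] : (\bigcup_i N i) A by rewrite -MN.
have nearA w : (forall j, p j <= w j <= (p j).+1)%N -> near_set A (x w).
  by move=> pw; exists (x p) => //; exact: xD.
have [w [w' [pw pw' /negP]]] := hp i; apply; apply/eqP.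
have [[q qi Aq]|noq] := pselect (exists2 q, q i = 0%N & near_set A (x q)).
  have allow v : (forall j, p j <= v j <= (p j).+1)%N -> linked i v.
    by move=> pv; exists A; split=> //; [exact: nearA|exists q].
  by rewrite !(asboolT (allow _ _))// !andbF.
have high v : (forall j, p j <= v j <= (p j).+1)%N ->
    (v i != 0%N) && ~~ `[< linked i v >].
  move=> pv; apply/andP; split.
    by apply/eqP => vi; apply: noq; exists v => //; exact: nearA.
  apply/asboolP => -[A' [NA' [c A'c Dvc] hq]].
  have AA' : A <> A' by move=> AA'; apply: noq; rewrite AA'.
  have [b Ab Dvb] := nearA v pv.
  have := Ndisj i A A' NA NA' AA'.
  rewrite -subset0 => /(_ c); apply; split=> //.
  exists b => //; rewrite /xsection /= inE; left => /=.
  exists (b - c); last by rewrite subrK.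
  by exists (x v - c) => //; exists (x v - b) => //; rewrite opprB addrC addrA subrK.
by rewrite !high.
Qed.
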